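(* Let $W$ be a finite complex reflection group acting on $V=\mathbb{C}^\ell$ with homogeneous basic invariants $f_1,\ldots,f_\ell$, and suppose $i_0\in\{1,\ldots,\ell\}$ satisfies $$V^{\mathrm{reg}}\cap\bigcap_{i\ne i_0}f_i^{-1}\{0\}\ne\varnothing.$$ Then for each $m=0,1,\ldots,\ell$, the set $$\mathcal{B}^{(m)}=\{df_I\,d\theta_k: I\subseteq[\ell]\setminus\{i_0\},\ |I|=m-1,\ k\in[\ell]\}\ \sqcup\ \{df_I\,\theta_k: I\subseteq[\ell]\setminus\{i_0\},\ |I|=m,\ k\in[\ell]\}$$ is a $K$-vector space basis of $K\otimes\wedge^m V^*\otimes V$.
   Context: $S=\mathbb{C}[x_1,\ldots,x_\ell]=\mathrm{Sym}(V^* )$ (polynomial functions on $V$; $x_i$ a basis of $V^*$ with dual basis $y_i$), $K=\mathbb{C}(x_1,\ldots,x_\ell)$; $W$ acts by linear substitution. $S^W=\mathbb{C}[f_1,\ldots,f_\ell]$, and $\theta_1,\ldots,\theta_\ell$ is an $S^W$-basis of $(S\otimes V)^W$ with each $\theta_k=\sum_i\theta_k^{(i)}\otimes y_i$ having all $\theta_k^{(i)}$ homogeneous of a common degree. $V^{\mathrm{reg}}$ is the set of vectors of $V$ lying on no reflecting hyperplane of $W$. $df=\sum_i\frac{\partial f}{\partial x_i}\otimes x_i$, $df_I=df_{i_1}\wedge\cdots\wedge df_{i_m}$ for $I=\{i_1<\cdots<i_m\}$; products like $df_I\theta_k$ are taken in $S\otimes\wedge V^*\otimes V$ as a module over $S\otimes\wedge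 V^*$; $S\otimes V$ is identified with its image under $f\otimes y\mapsto f\otimes1\otimes y$ and $d(f\otimes\omega\otimes y)=\sum_i\frac{\partial f}{\partial x_i}\otimes(x_i\wedge\omega)\otimes y$. $[\ell]=\{1,\ldots,\ell\}$; the first set is empty when $m=0$.
   Formalization: The formal theorem additionally assumes that W fixes no nonzero vector of V (V^W = 0); otherwise some θ_k has degree 0, so dθ_k = 0 lies in B^(1) and the claim fails (e.g. W = {1, diag(1,−1)} on C², i_0 = 2). *)

(* Defs.v *)
From mathcomp Require Import all_boot all_order all_algebra.
From mathcomp Require Import all_fingroup all_field all_character.
From mathcomp Require Import reals complex mpoly.

Set Implicit Arguments.
Unset Strict Implicit.
Unset Printing Implicit Defensive.

Import GRing.Theory.
Local Open Scope ring_scope.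

(* R (x) /\V^* : the form w is the sum over J = {j_1 < ... < j_m} of           *)
(* w J (x) x_{j_1} /\ ... /\ x_{j_m}.                                         *)
Notation extform R l := {ffun {set 'I_l} -> R^o}.

(* R (x) /\V^* (x) V : the value at i is the form that multiplies y_i.        *)
Notation vecform R l := {ffun 'I_l -> extform R l}.

Section Forms.
Variables (R : comNzRingType) (l : nat).

(* x_I /\ x_J = (-1) ^ (inversions I J) x_{I u J} for disjoint I, J. *)
Definition inversions (I J : {set 'I_l}) : nat :=
  #|[set p : 'I_l * 'I_l | [&& p.1 \in I, p.2 \in J & (p.2 < p.1)%N]]|.

Definition wedge (a b : extform R l) : extform R l :=
  [ffun J : {set 'I_l} =>
    \sum_(I : {set 'I_l} | I \subset J)
      (-1) ^+ inversions I (J :\: I) * a I * b (J :\: I)].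

Definition monoform (J : {set 'I_l}) : extform R l :=
  [ffun J' : {set 'I_l} => (J' == J)%:R].

Definition vecmono (J : {set 'I_l}) (i : 'I_l) : vecform R l :=
  [ffun i' : 'I_l => if i' == i then monoform J else 0].

Definition wedgev (a : extform R l) (b : vecform R l) : vecform R l :=
  [ffun i : 'I_l => wedge a (b i)].

Definition vec_to_vecform (t : 'cV[R]_l) : vecform R l :=
  [ffun i : 'I_l => (t i 0 : R) *: monoform set0].

End Forms.

Section Differential.
Variables (R : comNzRingType) (l : nat).
Notation S := {mpoly R[l]}.

Definition dform (w : extform S l) : extform S l :=
  \sum_(i < l) wedge (monoform S [set i])
                     [ffun J : {set 'I_l} => mderiv i (w J) : S].

Definition dvec (w : vecform S l) : vecform S l :=
  [ffun i : 'I_l => dform (w i)].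

Definition dpoly (p : S) : extform S l :=
  \sum_(i < l) (mderiv i p : S) *: monoform S [set i].

(* enum I is increasing, so this is df_{i_1} /\ ... /\ df_{i_m}. *)
Definition dpolys (f : l.-tuple S) (I : {set 'I_l}) : extform S l :=
  \big[@wedge S l/monoform S set0]_(i <- enum I) dpoly (tnth f i).

End Differential.

Section FractionField.
Variables (D : idomainType) (l : nat).

Definition frac_vecform (w : vecform D l) : vecform {fraction D} l :=
  [ffun i : 'I_l => [ffun J : {set 'I_l} => tofrac (w i J : D)]].

(* Frac(D) (x) /\^m V^* (x) V *)
Definition vecform_space (m : nat) : {vspace vecform {fraction D} l} :=
  (\sum_(J : {set 'I_l} | #|J| == m) \sum_(i < l) <[vecmono {fraction D} J i]>)%VS.

End FractionField.

Section ReflectionGroups.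
Variables (F : fieldType) (l : nat) (gT : finGroupType) (G : {group gT}).
Variable rG : mx_representation F G l.
Notation S := {mpoly F[l]}.

(* Matrices act on V = 'cV_l from the left; the column space of               *)
(* cokermx (A - 1) is the fixed space of A, which must be a hyperplane.       *)
Definition is_reflection (A : 'M[F]_l) : bool :=
  (\rank (cokermx (A - 1%:M))).+1 == l.

Definition reflection_group : Prop :=
  mx_faithful rG /\ <<[set s in G | is_reflection (rG s)]>>%g = G.

(* V^W = 0. If V^W <> 0 then some homogeneous basis element of (S (x) V)^W has *)
(* degree 0, so its differential vanishes.                                    *)
Definition essential : Prop :=
  forall v : 'cV[F]_l, (forall w, w \in G -> rG w *m v = v) -> v = 0.

Definition regular_vector (v : 'cV[F]_l) : Prop :=
  forall s, s \in G -> is_reflection (rG s) -> rG s *m v != v.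

(* (w p)(v) = p(w^-1 v) *)
Definition poly_act (w : gT) (p : S) : S :=
  p \mPo [tuple \sum_(j < l) (rG (w^-1)%g i j) *: 'X_j | i < l].

Definition poly_invariant (p : S) : Prop :=
  forall w, w \in G -> poly_act w p = p.

(* The diagonal action on S (x) V, where the column t stands for              *)
(* \sum_i t_i (x) y_i.                                                        *)
Definition vec_act (w : gT) (t : 'cV[S]_l) : 'cV[S]_l :=
  map_mx (fun c => c%:MP_[l]) (rG w) *m map_mx (poly_act w) t.

Definition vec_invariant (t : 'cV[S]_l) : Prop :=
  forall w, w \in G -> vec_act w t = t.

Definition basic_invariants (f : l.-tuple S) : Prop :=
  [/\ forall i, exists d : nat, tnth f i \is d.-homog,
      forall i, poly_invariant (tnth f i),
      forall p : S, poly_invariant p -> exists q : S, p = q \mPo f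
    & forall q : S, q \mPo f = 0 -> q = 0].

Definition invariant_vector_basis (theta : 'I_l -> 'cV[S]_l) : Prop :=
  [/\ forall k, vec_invariant (theta k),
      forall t, vec_invariant t -> exists2 c : 'I_l -> S,
        forall k, poly_invariant (c k) & t = \sum_k c k *: theta k
    & forall c : 'I_l -> S, (forall k, poly_invariant (c k)) ->
        \sum_k c k *: theta k = 0 -> forall k, c k = 0].

End ReflectionGroups.

Section Basis.
Variables (F : fieldType) (l : nat).
Notation S := {mpoly F[l]}.

(* |A| = m - 1 is stated as |A| + 1 = m, so that the first part is empty for  *)
(* m = 0. The elements are listed with multiplicity, hence a basis must have  *)
(* no repetition.                                                             *)
Definition theta_family (f : l.-tuple S) (theta : 'I_l -> 'cV[S]_l)
    (i0 : 'I_l) (m : nat) : seq (vecform {fraction S} l) :=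
  [seq frac_vecform (wedgev (dpolys f A) (dvec (vec_to_vecform (theta k))))
     | A <- enum [set A : {set 'I_l} | (i0 \notin A) && (#|A|.+1 == m)],
       k <- enum 'I_l]
  ++
  [seq frac_vecform (wedgev (dpolys f A) (vec_to_vecform (theta k)))
     | A <- enum [set A : {set 'I_l} | (i0 \notin A) && (#|A| == m)],
       k <- enum 'I_l].

End Basis.

(* Main.v *)
From HB Require Import structures.
Require Import Defs.
From mathcomp Require Import all_boot all_order all_algebra.
From mathcomp Require Import all_fingroup all_field all_character.
From mathcomp Require Import reals complex mpoly.
Import GRing.Theory.
Local Open Scope ring_scope.

(* The theta_k form a K-basis of K (x) V and the df_i form one of K (x) V^*, so     *)
(* the df_I theta_k with |I| = m form a basis of K (x) /\^m V^* (x) V. Expanding    *)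
(* dtheta_k = \sum_i df_i (d theta_k / d f_i), those I that contain i0 can be       *)
(* traded for the products df_I dtheta_k as soon as the derivative of               *)
(* theta_1, ..., theta_l along f_{i0} is an invertible matrix. At a regular         *)
(* vector v killed by the other f_i, the Euler field is a multiple of d / d f_{i0}, *)
(* so this matrix is, up to a scalar, diag(deg theta_k) times the matrix of the     *)
(* theta_k(v); essentiality makes the degrees positive.                             *)
(*   What remains is that the Jacobian J of f and det(theta) do not vanish at       *)
(* regular vectors. Averaging over W an interpolating element of S (x) S that       *)
(* vanishes on the graphs of all w != 1 shows that both divide a power of           *)
(* \prod_{w != 1} (lam_w - w lam_w), for every choice of linear forms lam_w. A      *)
(* linear form b with b(v) = 0 does not divide all of these products, because       *)
(* the image of 1 - w on V^* is contained in the line of b only if w is a           *)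
(* reflection that fixes v; hence b can be cancelled from the product.              *)

(** Counting reduces the claim to spanning: by [card_sets_pivot] the family has one member for each
    pair of an m-subset and a basis vector of V, and [dim_vecform_space] bounds this number by the
    dimension. Spanning is the exchange of [tensv_any_seq_mem], completed in [vecmono_mem] and
    applied in [theta_family_span] with coefficients taken from the inverse Jacobian over K. The
    three nonzero determinants it requires come from [partial_mx_det_neq0], which combines Euler's
    identity ([partial_mx_eval]) with nonvanishing at regular vectors: [jacobian_dvd] and
    [coord_mx_dvd] obtain the divisibilities by averaging, and [regular_nonvanishing] turns them
    into nonzero values. *)

Set Implicit Arguments.
Unset Strict Implicit.
Unset Printing Implicit Defensive.

(** * Linear forms and their cancellation *)

Lemma lrmorph_mpoly_ext (F : comNzRingType) (n : nat) (A : comAlgType F)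
    (phi psi : {lrmorphism {mpoly F[n]} -> A}) :
  (forall i, phi 'X_i = psi 'X_i) -> phi =1 psi.
Proof.
move=> eX p; rewrite [p]mpolyE !linear_sum; apply: eq_bigr => m _.
rewrite !linearZ /= mpolyXE_id !rmorph_prod /=; congr (_ *: _).
by apply: eq_bigr => i _; rewrite !rmorphXn /= eX.
Qed.

Lemma mpoly_ring_ind (F : comNzRingType) (n : nat) (P : {mpoly F[n]} -> Prop) :
  (forall c, P c%:MP) -> (forall i, P 'X_i) ->
  (forall p q, P p -> P q -> P (p + q)) ->
  (forall p q, P p -> P q -> P (p * q)) -> forall p, P p.
Proof.
move=> PC PX PD PM; have P1 : P 1 by rewrite -[1]/(1%:MP).
apply: mpolyind => [|c m p _ _ Pp]; first by rewrite -mpolyC0.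
apply: (PD _ _ _ Pp); rewrite -mul_mpolyC; apply: (PM _ _ (PC c)).
rewrite mpolyXE_id; apply: (big_ind P) => // i _.
by elim: (m i) => [|k IH]; rewrite ?expr0 // exprS; apply: PM.
Qed.

Section LinearForms.
Variables (F : fieldType) (l : nat).
Notation S := {mpoly F[l]}.
Implicit Types (a b : 'rV[F]_l) (p q D : S).

Definition linear_form a : S := \sum_j a 0 j *: 'X_j.

Lemma linear_formB a b : linear_form (a - b) = linear_form a - linear_form b.
Proof.
by rewrite -sumrB; apply: eq_bigr => j _; rewrite !mxE scalerBl.
Qed.

Lemma linear_formZ c a : linear_form (c *: a) = c *: linear_form a.
Proof.
by rewrite scaler_sumr; apply: eq_bigr => j _; rewrite !mxE scalerA.
Qed.

Lemma meval_linear_form a (v : 'cV[F]_l) :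
  (linear_form a).@[fun j => v j 0] = (a *m v) 0 0.
Proof.
by rewrite mxE raddf_sum /=; apply: eq_bigr => j _; rewrite mevalZ mevalXU.
Qed.

Lemma linear_form_eq0 a : (linear_form a == 0) = (a == 0).
Proof.
apply/eqP/eqP => [a0|->]; last first.
  by rewrite /linear_form big1 // => j _; rewrite mxE scale0r.
apply/rowP => j; have := congr1 (meval (fun i => (delta_mx j 0 : 'cV_l) i 0)) a0.
by rewrite meval_linear_form -colE meval0 !mxE.
Qed.

Lemma comp_linear_form (t : l.-tuple S) a :
  linear_form a \mPo t = \sum_j a 0 j *: tnth t j.
Proof.
rewrite raddf_sum /=; apply: eq_bigr => j _.
by rewrite comp_mpolyZ comp_mpolyXU -tnth_nth.
Qed.

(* The composition with the projection along [e] onto the kernel of [b], when *)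
(* [b e = 1].                                                                 *)
Definition restrict_to_ker b (e : 'cV[F]_l) p : S :=
  p \mPo [tuple 'X_i - e i 0 *: linear_form b | i < l].

Lemma restrict_to_ker_linear b e a :
  restrict_to_ker b e (linear_form a) = linear_form (a - (a *m e) 0 0 *: b).
Proof.
rewrite /restrict_to_ker comp_linear_form linear_formB linear_formZ mxE.
under eq_bigr => j _ do rewrite tnth_mktuple scalerBr scalerA.
by rewrite sumrB scaler_suml.
Qed.

(** Each variable moves by a multiple of [linear_form b], and congruence modulo [linear_form b]
    respects sums and products. *)
Lemma restrict_to_ker_dvd b e p :
  exists q, p - restrict_to_ker b e p = linear_form b * q.
Proof.
rewrite /restrict_to_ker.
elim/mpoly_ring_ind: p => [c|i|p q [p' Ep] [q' Eq]|p q [p' Ep] [q' Eq]].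
- by exists 0; rewrite comp_mpolyC subrr mulr0.
- exists (e i 0)%:MP; rewrite comp_mpolyXU -tnth_nth tnth_mktuple opprB.
  by rewrite addrC subrK mulrC mul_mpolyC.
- by exists (p' + q'); rewrite rmorphD /= opprD addrACA Ep Eq mulrDr.
- exists (p' * q + (p \mPo [tuple 'X_i - e i 0 *: linear_form b | i < l]) * q').
  rewrite rmorphM /= mulrDr !mulrA -Ep (mulrC (linear_form b)).
  by rewrite -(mulrA (_ \mPo _)) -Eq mulrBl mulrBr addrA subrK.
Qed.

(* [p] can be cancelled from [q * p] at the cost of a unit [r] at [v]. *)
Definition removable_at (D : S) (v : 'cV[F]_l) (p : S) : Prop :=
  forall A q, D * A = q * p ->
    exists A' r, D * A' = q * r /\ r.@[fun j => v j 0] != 0.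

(** Since [removable_at] allows any cofactor [q], the unit left by one factor is absorbed in [q]
    before the next factor is cancelled. *)
Lemma removable_at_prod D (v : 'cV[F]_l) (I : finType) (P : pred I) (E : I -> S) :
  (forall i, P i -> removable_at D v (E i)) ->
  removable_at D v (\prod_(i | P i) E i).
Proof.
move=> rE; apply: big_ind => // [A q|p p' rp rp' A q].
  by exists A, 1; rewrite meval1 oner_eq0.
rewrite mulrA => /rp'[A' [r [DA' nzr]]].
have [|A2 [r2 [DA2 nzr2]]] := rp A' (q * r).
  by rewrite DA' mulrAC.
by exists A2, (r * r2); rewrite mulrA mevalM mulf_neq0.
Qed.

Lemma removable_at_exp D (v : 'cV[F]_l) p n :
  removable_at D v p -> removable_at D v (p ^+ n).
Proof. by move=> rp; rewrite -[n]card_ord -prodr_const; apply: removable_at_prod. Qed.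

Lemma removable_at_nonzero D (v : 'cV[F]_l) p :
  p.@[fun j => v j 0] != 0 -> removable_at D v p.
Proof. by move=> nzp A q DA; exists A, p. Qed.

(** Restriction to the kernel of [b] is a ring morphism into a domain that kills [linear_form b] but
    not [D]; so it kills [A], which is then a multiple of [linear_form b]. *)
Lemma removable_at_linear D (v : 'cV[F]_l) b e :
  (b *m e) 0 0 = 1 -> restrict_to_ker b e D != 0 ->
  removable_at D v (linear_form b).
Proof.
move=> be nzD A q DA; have [A' EA'] := restrict_to_ker_dvd b e A.
have b0: restrict_to_ker b e (linear_form b) = 0.
  by rewrite restrict_to_ker_linear be scale1r subrr; apply/eqP; rewrite linear_form_eq0.
have /eqP: restrict_to_ker b e (D * A) = 0.
  by rewrite DA /restrict_to_ker rmorphM /= -!/(restrict_to_ker _ _ _) b0 mulr0.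
rewrite /restrict_to_ker rmorphM /= mulf_eq0 -!/(restrict_to_ker _ _ _) (negPf nzD) /=.
move/eqP=> A0; move: EA'; rewrite A0 subr0 => EA.
exists A', 1; rewrite meval1 oner_eq0 mulr1; split=> //.
have nzb: linear_form b != 0.
  rewrite linear_form_eq0; apply: contra_eq_neq be => ->.
  by rewrite mul0mx mxE eq_sym oner_eq0.
by apply: (mulfI nzb); rewrite mulrCA -EA DA mulrC.
Qed.

End LinearForms.

(** * Displacements of linear forms and regular vectors *)

Section Groups.
Variables (F : fieldType) (l : nat) (gT : finGroupType) (G : {group gT}).
Variable rG : mx_representation F G l.
Notation S := {mpoly F[l]}.
Local Notation act := (poly_act rG).

Lemma poly_act_linear_form w a :
  act w (linear_form a) = linear_form (a *m rG (w^-1)%g).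
Proof.
rewrite /poly_act comp_linear_form; under eq_bigr => j _ do
  rewrite tnth_mktuple scaler_sumr.
rewrite exchange_big; apply: eq_bigr => j _ /=; rewrite mxE scaler_suml.
by apply: eq_bigr => i _; rewrite scalerA.
Qed.

Lemma poly_actM w w' p : w \in G -> w' \in G ->
  act (w * w')%g p = act w (act w' p).
Proof.
move=> Gw Gw'; set t := fun w => [tuple \sum_(j < l) (rG (w^-1)%g i j) *: 'X_j | i < l].
apply: (@lrmorph_mpoly_ext _ _ _ (comp_mpoly (t (w * w')%g))
   (comp_mpoly (t w) \o comp_mpoly (t w'))) => i /=.
rewrite !comp_mpolyXU -!tnth_nth !tnth_mktuple.
pose a u := row i (rG (u^-1)%g).
have ta u : \sum_(j < l) rG (u^-1)%g i j *: 'X_j = linear_form (a u).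
  by apply: eq_bigr => j _; rewrite mxE.
rewrite !ta -/(act w _) poly_act_linear_form /a invMg repr_mxM ?groupV //.
by rewrite row_mul.
Qed.

Definition displacement (lam : gT -> 'rV[F]_l) (w : gT) : 'rV[F]_l :=
  lam w *m (1%:M - rG (w^-1)%g).

(* It vanishes at the points fixed by some [w != 1]; over all [lam], these are *)
(* the only common zeros.                                                      *)
Definition displacement_prod (lam : gT -> 'rV[F]_l) : S :=
  \prod_(w | (w \in G) && (w != 1%g)) linear_form (displacement lam w).

Hypothesis faithG : mx_faithful rG.

Lemma displacement_mx_neq0 w : w \in G -> w != 1%g -> 1%:M - rG (w^-1)%g != 0.
Proof.
move=> Gw; apply: contra_neq => /eqP; rewrite subr_eq0 => /eqP e1.
apply: invg_inj; rewrite invg1; apply: (mx_faithful_inj faithG); rewrite ?groupV //.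
by rewrite -e1 repr_mx1.
Qed.

(** If all rows of M = 1 - w^-1 were multiples of [b], then M = (M e) b would have rank one, so w^-1
    would be a reflection, and M v = (M e)(b v) = 0 would put the regular vector [v] on its
    hyperplane. *)
Lemma regular_displacement (v e : 'cV[F]_l) (b : 'rV[F]_l) w :
    regular_vector rG v -> (b *m v) 0 0 = 0 -> w \in G -> w != 1%g ->
  exists lam : 'rV[F]_l, lam *m (1%:M - rG (w^-1)%g) -
     (lam *m (1%:M - rG (w^-1)%g) *m e) 0 0 *: b != 0.
Proof.
move=> regv bv Gw w1; set M := 1%:M - _.
have M0 : M != 0 by apply: displacement_mx_neq0.
have [j nzj|all0] := pickP (fun j => row j M - (row j M *m e) 0 0 *: b != 0).
  by exists (delta_mx 0 j); rewrite -rowE.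
have Mb : M = M *m e *m b.
  apply/row_matrixP => j; have /negbFE := all0 j.
  rewrite subr_eq0 => /eqP {1}->; rewrite row_mul row_mul -mul_scalar_mx.
  by congr (_ *m b); rewrite [RHS]mx11_scalar.
have rkM : \rank M = 1%N.
  apply/eqP; rewrite eqn_leq lt0n mxrank_eq0 M0 andbT Mb.
  by rewrite (leq_trans (mxrankM_maxl _ _)) // rank_leq_col.
have Gw' : (w^-1)%g \in G by rewrite groupV.
have refl : is_reflection (rG (w^-1)%g).
  rewrite /is_reflection -[_ - _]opprB mxrank_coker mxrank_opp rkM.
  by rewrite subn1 prednK // -rkM (leq_trans _ (rank_leq_row M)) ?rkM.
case/negP: (regv _ Gw' refl); apply/eqP.
have : M *m v = 0.
  by rewrite Mb -mulmxA [b *m v]mx11_scalar bv raddf0 mulmx0.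
by move/eqP; rewrite mulmxBl mul1mx subr_eq0 eq_sym => /eqP.
Qed.

Lemma regular_nonvanishing (D : S) (v : 'cV[F]_l) n :
    regular_vector rG v ->
    (forall lam, exists A, D * A = displacement_prod lam ^+ n) ->
  D.@[fun j => v j 0] != 0.
Proof.
move=> regv dvdD.
(* A first [lam] without zero displacements; its product is taken apart factor by factor. *)
have /fin_all_exists[lam Hlam] w : exists a : 'rV[F]_l, w \in G -> w != 1%g ->
    let b := a *m (1%:M - rG (w^-1)%g) in b != 0.
  have [Gw|] := boolP (w \in G); last by exists 0.
  have [->|w1] := eqVneq w 1%g; first by exists 0.
  have /rowV0Pn[b /submxP[a ->] nzb] := displacement_mx_neq0 Gw w1.
  by exists a.
have rem : removable_at D v (displacement_prod lam ^+ n).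
  apply: removable_at_exp; apply: removable_at_prod => w /andP[Gw w1].
  set b := displacement lam w; have nzb : b != 0 by apply: Hlam.
  move: b nzb => b nzb.
  have [bv|bv] := eqVneq ((b *m v) 0 0) 0; last first.
    by apply: removable_at_nonzero; rewrite meval_linear_form.
  have [j nzj] : exists j, b 0 j != 0 by apply/rV0Pn.
  pose e : 'cV_l := (b 0 j)^-1 *: delta_mx j 0.
  have be : (b *m e) 0 0 = 1 by rewrite -scalemxAr -colE !mxE mulVf.
  apply: (removable_at_linear v be).
  (* A second choice, adapted to [b]: its product is nonzero on the kernel of [b], and [D] divides a
     power of it, so [D] is nonzero there too. *)
  have /fin_all_exists[lam' Hlam'] u : exists a : 'rV[F]_l, u \in G -> u != 1%g ->
     a *m (1%:M - rG (u^-1)%g) - (a *m (1%:M - rG (u^-1)%g) *m e) 0 0 *: b != 0.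
    have [Gu|] := boolP (u \in G); last by exists 0.
    have [->|u1] := eqVneq u 1%g; first by exists 0.
    by have [a Ha] := regular_displacement e regv bv Gu u1; exists a.
  have [A DA] := dvdD lam'.
  have : restrict_to_ker b e (D * A) != 0.
    rewrite DA /restrict_to_ker rmorphXn rmorph_prod expf_neq0 //.
    apply/prodf_neq0 => u /andP[Gu u1] /=.
    by rewrite -/(restrict_to_ker _ _ _) restrict_to_ker_linear linear_form_eq0 Hlam'.
  by rewrite /restrict_to_ker rmorphM mulf_eq0 => /norP[].
(* With q = 1, [D] divides a polynomial [r] that is nonzero at [v]. *)
have [A DA] := dvdD lam; have [|A' [r [DA' nzr]]] := rem A 1; first by rewrite mul1r.
by move: nzr; apply: contraNneq => Dv; rewrite -[r]mul1r -DA' mevalM Dv mul0r.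
Qed.

End Groups.

(** * Averaging over the group *)

Lemma det_dvd_of_scalar (A : comNzRingType) n (M : 'M[A]_n) (c : A) :
    (forall j, exists u : 'rV_n, u *m M = c *: delta_mx 0 j) ->
  exists B, \det M * B = c ^+ n.
Proof.
move=> /fin_all_exists[u Eu]; pose N := \matrix_j u j.
exists (\det N); rewrite mulrC -det_mulmx; have -> : N *m M = c%:M.
  apply/row_matrixP => j; rewrite row_mul rowK Eu.
  by apply/rowP => k; rewrite !mxE eqxx mulr_natr eq_sym.
by rewrite det_scalar.
Qed.

(** The chain rule; what matters is that the [g i] do not depend on [j], so that the gradient is a
    row vector times the Jacobian matrix. *)
Lemma mderiv_comp_mpoly (A : comNzRingType) n k (f : n.-tuple {mpoly A[k]}) q :
  exists g : 'I_n -> {mpoly A[k]}, forall j,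
    mderiv j (q \mPo f) = \sum_i g i * mderiv j (tnth f i).
Proof.
elim/mpoly_ring_ind: q => [c|i|p q [g Eg] [h Eh]|p q [g Eg] [h Eh]].
- exists (fun=> 0) => j; rewrite comp_mpolyC mderivC big1 // => i _.
  by rewrite mul0r.
- exists (fun i' => (i' == i)%:R) => j; rewrite comp_mpolyXU -tnth_nth.
  rewrite (bigD1 i) //= eqxx mul1r big1 ?addr0 // => i' /negPf->.
  by rewrite mul0r.
- exists (fun i => g i + h i) => j; rewrite rmorphD mderivD Eg Eh -big_split.
  by apply: eq_bigr => i _; rewrite mulrDl.
- exists (fun i => g i * (q \mPo f) + (p \mPo f) * h i) => j.
  rewrite rmorphM mderivM Eg Eh mulr_suml mulr_sumr -big_split.
  by apply: eq_bigr => i _ /=; rewrite mulrDl mulrAC mulrA.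
Qed.

Section Averaging.
Variables (F : fieldType) (l : nat) (gT : finGroupType) (G : {group gT}).
Variable rG : mx_representation F G l.
Notation S := {mpoly F[l]}.
Local Notation act := (poly_act rG).
Implicit Types (w : gT) (s : seq (S * S)).

HB.instance Definition _ w := GRing.LRMorphism.copy (act w)
  (comp_mpoly [tuple \sum_(j < l) (rG (w^-1)%g i j) *: 'X_j | i < l]).

Lemma poly_act_mul w p q : act w (p * q) = act w p * act w q.
Proof. exact: rmorphM. Qed.

Lemma poly_actC w c : act w c%:MP = c%:MP.
Proof. exact: comp_mpolyC. Qed.

Lemma poly_act_sum (I : Type) (r : seq I) (P : pred I) (E : I -> S) w :
  act w (\sum_(i <- r | P i) E i) = \sum_(i <- r | P i) act w (E i).
Proof. exact: raddf_sum. Qed.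

Lemma vec_actE w t i :
  vec_act rG w t i 0 = \sum_j (rG w i j)%:MP * act w (t j 0).
Proof. by rewrite mxE; apply: eq_bigr => j _; rewrite !mxE. Qed.

Lemma vec_actM w w' t : w \in G -> w' \in G ->
  vec_act rG (w * w')%g t = vec_act rG w (vec_act rG w' t).
Proof.
move=> Gw Gw'; apply/colP => i.
apply: etrans (vec_actE _ _ _) (etrans _ (esym (vec_actE _ _ _))).
transitivity (\sum_k \sum_j (rG w i k * rG w' k j)%:MP * act (w * w')%g (t j 0)).
  rewrite exchange_big; apply: eq_bigr => j _.
  by rewrite repr_mxM // mxE raddf_sum mulr_suml.
apply: eq_bigr => k _; rewrite vec_actE poly_act_sum mulr_sumr.
apply: eq_bigr => j _.
by rewrite poly_act_mul poly_actC mulrA -mpolyCM -poly_actM.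
Qed.

Lemma vec_act_additive w : zmod_morphism (vec_act rG w).
Proof. by move=> t u; rewrite /vec_act map_mxB mulmxBr. Qed.

HB.instance Definition _ w :=
  GRing.isZmodMorphism.Build 'cV[S]_l 'cV[S]_l (vec_act rG w) (vec_act_additive w).

(* [fun w => tens s w] is an element of S (x) S whose second factor is         *)
(* translated by [w]; [dtens] differentiates that factor.                      *)
Definition tens s w : S := \sum_(x <- s) x.1 * act w x.2.
Definition dtens s w (k : 'I_l) : S := \sum_(x <- s) x.1 * mderiv k (act w x.2).

(** Pairwise products of terms give the product in S (x) S; the Leibniz rule holds because only the
    second factor is differentiated. *)
Lemma tensM s1 s2 : exists s, forall w, tens s w = tens s1 w * tens s2 w /\
  forall k, dtens s w k = dtens s1 w k * tens s2 w + tens s1 w * dtens s2 w k.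
Proof.
exists [seq (xy.1.1 * xy.2.1, xy.1.2 * xy.2.2) | xy <- [seq (x, y) | x <- s1, y <- s2]].
move=> w; split=> [|k]; rewrite /tens /dtens big_map big_allpairs.
  rewrite big_distrlr; apply: eq_bigr => x _; apply: eq_bigr => y _ /=.
  by rewrite poly_act_mul mulrACA.
rewrite !big_distrlr -big_split; apply: eq_bigr => x _ /=.
rewrite -big_split; apply: eq_bigr => y _ /=.
by rewrite poly_act_mul mderivM mulrDr; congr (_ + _); rewrite mulrACA.
Qed.

(** The element is 1 (x) p - q (x) 1. *)
Lemma tens_sub p q : exists s, forall w, tens s w = act w p - q /\
  forall k, dtens s w k = mderiv k (act w p).
Proof.
exists [:: (1, p); (- q, 1)] => w; rewrite /tens /dtens; split=> [|k].
  by rewrite !big_cons big_nil /= rmorph1 mul1r mulr1 addr0.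
by rewrite !big_cons big_nil /= rmorph1 mul1r -mpolyC1 mderivC mulr0 !addr0.
Qed.

Lemma tens_prod (I : Type) (r : seq I) (P : pred I) (h : I -> gT -> S) :
    (forall i, P i -> exists s, forall w, tens s w = h i w) ->
  exists s, forall w, tens s w = \prod_(i <- r | P i) h i w.
Proof.
move=> th; elim: r => [|i r [s Es]].
  exists [:: (1, 1)] => w; rewrite /tens big_cons !big_nil /= mul1r addr0.
  exact: rmorph1.
have [Pi|nPi] := boolP (P i); last first.
  by exists s => w; rewrite big_cons (negPf nPi).
have [s' Es'] := th i Pi; have [s2 Es2] := tensM s' s.
by exists s2 => w; rewrite big_cons Pi; have [-> _] := Es2 w; rewrite Es' Es.
Qed.

Lemma act1 p : act 1%g p = p.
Proof.
rewrite /poly_act -[RHS]comp_mpoly_id; congr (p \mPo _); apply/eq_mktuple => i.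
rewrite invg1 repr_mx1 (bigD1 i) //= big1 ?mxE ?eqxx ?scale1r ?addr0 // => j ji.
by rewrite mxE eq_sym (negPf ji) scale0r.
Qed.

(** The product over u != 1 of 1 (x) lam_u - (u lam_u) (x) 1 has a zero factor at each w != 1 and
    equals [displacement_prod] at w = 1. Squaring it makes the derivatives vanish at w != 1 as
    well. *)
Lemma tens_diagonal lam : exists s, forall w, w \in G ->
  tens s w = (w == 1%g)%:R * displacement_prod rG lam ^+ 2 /\
  (w != 1%g -> forall k, dtens s w k = 0).
Proof.
pose h u w := act w (linear_form (lam u)) - act u (linear_form (lam u)).
have [u _|s0 Es0] := @tens_prod gT (index_enum gT)
    (fun u => (u \in G) && (u != 1%g)) h.
  by have [s Es] := tens_sub (linear_form (lam u)) (act u (linear_form (lam u)));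
    exists s => w; have [] := Es w.
have s0_0 w : w \in G -> w != 1%g -> tens s0 w = 0.
  by move=> Gw w1; rewrite Es0 (bigD1 w) ?Gw //= /h subrr mul0r.
have s0_1 : tens s0 1%g = displacement_prod rG lam.
  rewrite Es0; apply: eq_bigr => u _.
  by rewrite /h act1 poly_act_linear_form -linear_formB /displacement mulmxBr mulmx1.
have [s Es] := tensM s0 s0; exists s => w Gw; have [-> Eds] := Es w.
have [->|w1] := eqVneq w 1%g; first by rewrite s0_1 mul1r expr2.
rewrite (s0_0 w) // !mul0r; split=> // _ k.
by rewrite Eds (s0_0 w) // mulr0 mul0r addr0.
Qed.

(** The extra factor 1 (x) x_j - x_j (x) 1 vanishes at w = 1, where its k-th derivative is 1 if k =
    j and 0 otherwise; at w != 1 the element of [tens_diagonal] vanishes together with its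
    derivatives. *)
Lemma dtens_diagonal lam (j : 'I_l) : exists s, forall w, w \in G -> forall k,
  dtens s w k = ((w == 1%g) && (k == j))%:R * displacement_prod rG lam ^+ 2.
Proof.
have [s0 Es0] := tens_diagonal lam; have [s1 Es1] := tens_sub 'X_j 'X_j.
have [s Es] := tensM s0 s1; exists s => w Gw k.
have [_ ->] := Es w; have [-> Es1k] := Es1 w; have [-> Eds0] := Es0 w Gw.
rewrite Es1k; have [->|w1] := eqVneq w 1%g; last by rewrite Eds0 // !mul0r addr0.
rewrite act1 subrr mulr0 add0r /= mul1r mulrC mderivX mnm1E eq_sym.
have [->|_] := eqVneq k j; rewrite ?scale0r ?mul0r // scale1r.
suff -> : (U_(j) - U_(j))%MM = 0%MM by rewrite mpolyX0.
by apply/mnmP => i; rewrite mnmBE mnm0E subnn.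
Qed.

Lemma sum_act_invariant p : poly_invariant rG (\sum_(w in G) act w p).
Proof.
move=> w Gw; rewrite poly_act_sum [RHS](reindex_inj (mulgI w)) /=.
apply: eq_big => u; first by rewrite groupMl.
by move=> Gu; rewrite -poly_actM.
Qed.

Lemma sum_vec_act_invariant t : vec_invariant rG (\sum_(w in G) vec_act rG w t).
Proof.
move=> w Gw; rewrite raddf_sum [RHS](reindex_inj (mulgI w)) /=.
apply: eq_big => u; first by rewrite groupMl.
by move=> Gu; rewrite -vec_actM.
Qed.

Definition jacobian (f : l.-tuple S) : 'M[S]_l :=
  \matrix_(i, j) mderiv j (tnth f i).

(** Summing [dtens s w k] over the group leaves only w = 1. The sum is also an S-combination of k-th
    derivatives of invariants, which are polynomials in the f_i; so by the chain rule some row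
    vector times the Jacobian is the square of [displacement_prod] times the j-th unit row. The
    determinant raises this square to the power l. *)
Lemma jacobian_dvd f lam : basic_invariants rG f ->
  exists A, \det (jacobian f) * A = displacement_prod rG lam ^+ (2 * l).
Proof.
case=> _ _ genf _; rewrite exprM; apply: det_dvd_of_scalar => j.
have [s Es] := dtens_diagonal lam j.
pose avg (p : S) := \sum_(w in G) act w p.
have /fin_all_exists[g Eg] (x : 'I_(size s)) : exists g : 'I_l -> S, forall k,
    mderiv k (avg (s`_x).2) = \sum_i g i * mderiv k (tnth f i).
  rewrite /avg; have [q ->] := genf _ (@sum_act_invariant (s`_x).2).
  exact: mderiv_comp_mpoly.
exists (\row_i \sum_(x < size s) (s`_x).1 * g x i); apply/rowP => k.
transitivity (\sum_(w in G) dtens s w k); last first.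
  rewrite (bigD1 1%g) //= big1 ?addr0 => [|w /andP[Gw /negPf w1]].
    by rewrite Es // eqxx !mxE eqxx /= mulrC.
  by rewrite Es // w1 mul0r.
under [RHS]eq_bigr => w _ do rewrite /dtens (big_nth 0) big_mkord.
rewrite exchange_big [LHS]mxE; under [LHS]eq_bigr => i _ do rewrite !mxE mulr_suml.
rewrite [LHS]exchange_big; apply: eq_bigr => x _ /=.
have := Eg x k; rewrite /avg (raddf_sum (mderiv k)) -mulr_sumr => ->.
rewrite mulr_sumr.
by apply: eq_bigr => i _; rewrite mulrA.
Qed.

Definition coord_mx (theta : 'I_l -> 'cV[S]_l) : 'M[S]_l :=
  \matrix_(k, j) theta k j 0.

(** The same averaging, applied to q (x) y_j: the sum of the [tens s w] times w y_j retains only w =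
    1, and it is an S-combination of invariant vectors, hence of the [theta k]. *)
Lemma coord_mx_dvd theta lam : invariant_vector_basis rG theta ->
  exists A, \det (coord_mx theta) * A = displacement_prod rG lam ^+ (2 * l).
Proof.
case=> _ gent _; rewrite exprM; apply: det_dvd_of_scalar => j.
have [s Es] := tens_diagonal lam.
pose avg (p : S) := \sum_(w in G) vec_act rG w (p *: delta_mx j 0).
have /fin_all_exists[g Eg] (x : 'I_(size s)) : exists g : 'I_l -> S,
    avg (s`_x).2 = \sum_k g k *: theta k.
  rewrite /avg.
  have [c _ ->] := gent _ (@sum_vec_act_invariant ((s`_x).2 *: delta_mx j 0)).
  by exists c.
exists (\row_k \sum_(x < size s) (s`_x).1 * g x k).
transitivity (\sum_(w in G) tens s w *: (map_mx (fun c => c%:MP_[l]) (row j (rG w)^T))).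
  under [RHS]eq_bigr => w _ do rewrite /tens (big_nth 0) big_mkord scaler_suml.
  rewrite exchange_big; apply/rowP => k; rewrite summxE [LHS]mxE.
  under [LHS]eq_bigr => i _ do rewrite !mxE mulr_suml.
  rewrite [LHS]exchange_big; apply: eq_bigr => x _ /=.
  have /matrixP/(_ k 0) := Eg x.
  rewrite /avg !summxE => Exk.
  transitivity ((s`_x).1 * \sum_i (g x i *: theta i) k 0).
    by rewrite mulr_sumr; apply: eq_bigr => i _; rewrite mxE mulrA.
  rewrite -Exk mulr_sumr; apply: eq_bigr => w _.
  rewrite !mxE (bigD1 j) //= big1 => [|i ij]; rewrite !mxE.
    by rewrite eqxx mulr1 addr0 -mulrA [X in _ = _ * X]mulrC.
  by rewrite (negPf ij) mulr0 raddf0 mulr0.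
rewrite (bigD1 1%g) //= big1 ?addr0 => [|w /andP[Gw /negPf w1]].
  have [-> _] := Es _ (group1 G); rewrite eqxx mul1r repr_mx1; congr (_ *: _).
  by apply/rowP => k; rewrite !mxE eqxx /=; case: eqP.
by have [-> _] := Es _ Gw; rewrite w1 mul0r scale0r.
Qed.

(* [\det (jacobian f)] times the derivatives of the [theta k] along f_{i0}. *)
Definition partial_mx (f : l.-tuple S) (theta : 'I_l -> 'cV[S]_l) (i0 : 'I_l) :
    'M[S]_l :=
  \matrix_(k, j) \sum_n \adj (jacobian f) n i0 * mderiv n (theta k j 0).

End Averaging.

(** * Euler's identity at a regular vector *)

Lemma euler_homog (A : comNzRingType) n (p : {mpoly A[n]}) d :
  p \is d.-homog -> \sum_j 'X_j * mderiv j p = p *+ d.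
Proof.
move/dhomogP => hp; transitivity (\sum_(m <- msupp p) (p@_m *: 'X_[m]) *+ d); last first.
  by rewrite sumrMnl -mpolyE.
under eq_bigr => j _ do rewrite {1}[p]mpolyE raddf_sum mulr_sumr.
rewrite exchange_big big_seq [RHS]big_seq; apply: eq_bigr => m pm.
have := hp m pm; rewrite /= mdegE => <-; rewrite -sumrMnr; apply: eq_bigr => j _ /=.
rewrite mderivZ mderivX scalerA -scalerAr -mpolyXD -scaler_nat scalerA.
(* For m j = 0 the truncated difference m - U_(j) is m itself, but its coefficient is zero. *)
have [->|nz] := eqVneq (m j) 0%N; first by rewrite mulr0 mul0r !scale0r.
rewrite [p@_m * _]mulrC; congr (_ *: 'X_[_]); apply/mnmP => i.
rewrite mnmDE mnmBE mnm1E; have [<-|_] := eqVneq j i; last by rewrite subn0.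
by rewrite subnKC // lt0n.
Qed.

Lemma homog0_const (A : nzRingType) n (p : {mpoly A[n]}) :
  p \is 0.-homog -> p = (p@_0)%:MP.
Proof.
move=> hp; apply/mpolyP => m; rewrite mcoeffC.
have [->|m0] := eqVneq m 0%MM; first by rewrite mulr1.
rewrite mulr0; apply: dhomog_nemf_coeff hp _.
by rewrite mdeg_eq0.
Qed.

Section AtRegularVector.
Variables (F : fieldType) (l : nat) (gT : finGroupType) (G : {group gT}).
Variable rG : mx_representation F G l.
Notation S := {mpoly F[l]}.

(** In degree 0 the vector [theta k] would be constant and fixed by the group, hence zero by
    essentiality, against independence. *)
Lemma invariant_basis_degree_gt0 (theta : 'I_l -> 'cV[S]_l) k d :
    essential rG -> invariant_vector_basis rG theta ->
    (forall i, theta k i 0 \is d.-homog) -> (0 < d)%N.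
Proof.
move=> ess [inv _ ind] homk; case: d homk => // homk.
pose v : 'cV[F]_l := \col_i (theta k i 0)@_0.
have tv i : theta k i 0 = (v i 0)%:MP.
  by rewrite mxE -homog0_const.
have v0 : v = 0.
  apply: ess => w Gw; apply/colP => i; apply: (can_inj (@mpolyCK l F)).
  rewrite -tv -(inv k w Gw) vec_actE mxE raddf_sum; apply: eq_bigr => j _.
  by rewrite tv poly_actC -mpolyCM.
have t0 : theta k = 0 by apply/colP => i; rewrite tv v0 !mxE.
have cinv k' : poly_invariant rG (k' == k)%:R.
  by move=> w _; case: eqP => _; [exact: rmorph1 | exact: rmorph0].
have /eqP : (k == k)%:R = 0 :> S; last by rewrite eqxx oner_eq0.
apply: (ind _ cinv).
by rewrite (bigD1 k) //= t0 scaler0 big1 ?addr0 // => k' /negPf->; rewrite scale0r.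
Qed.

(** Let J be the Jacobian at [v]. As the other f_i vanish there, Euler's identity gives J v = mu
    e_{i0}, with [mu] the degree of f_{i0} times its value; applying adj J, mu times column i0 of
    adj J is det(J) v. So mu times [partial_mx] is det(J) times the Euler derivative of the
    [theta k], which multiplies row k by [d k]. *)
Lemma partial_mx_eval f (theta : 'I_l -> 'cV[S]_l) i0 (v : 'cV[F]_l) (d : 'I_l -> nat) :
    (forall i, exists d, tnth f i \is d.-homog) ->
    (forall k j, theta k j 0 \is (d k).-homog) ->
    (forall i, i != i0 -> (tnth f i).@[fun j => v j 0] = 0) ->
  exists mu : F,
    mu *: map_mx (meval (fun j => v j 0)) (partial_mx f theta i0) =
      (\det (jacobian f)).@[fun j => v j 0] *:
        (diag_mx (\row_k (d k)%:R) *m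
           map_mx (meval (fun j => v j 0)) (coord_mx theta)).
Proof.
move=> homf homt zv; set ev := meval _.
pose Jv := map_mx ev (jacobian f).
have eulerv p e : p \is e.-homog -> \sum_j ev (mderiv j p) * v j 0 = ev p *+ e.
  move/euler_homog/(congr1 ev); rewrite /ev mevalMn => <-.
  rewrite raddf_sum; apply: eq_bigr => j _ /=.
  by rewrite mevalM mevalXU mulrC.
have [e he] := homf i0; exists (ev (tnth f i0) *+ e).
have Jvv : Jv *m v = (ev (tnth f i0) *+ e) *: delta_mx i0 0.
  apply/colP => i; rewrite !mxE; under eq_bigr => j _ do rewrite !mxE.
  have [e' he'] := homf i; rewrite (eulerv _ _ he') andbT.
  have [ii0|ii0] := eqVneq i i0; last by rewrite /ev zv // mul0rn mulr0.
  by rewrite mulr1 ii0 -!eulerv // -ii0.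
have adjv n : ev (tnth f i0) *+ e * ev (\adj (jacobian f) n i0) =
    ev (\det (jacobian f)) * v n 0.
  have := mulmxA (\adj Jv) Jv v; rewrite mul_adj_mx mul_scalar_mx Jvv -scalemxAr -colE.
  rewrite -map_mx_adj det_map_mx => /colP/(_ n) En.
  by rewrite [LHS]mxE [RHS]mxE [X in _ * X = _]mxE [X in _ * X = _]mxE in En.
apply/matrixP => k j; rewrite mul_diag_mx [LHS]mxE [RHS]mxE.
rewrite [X in _ * X = _]mxE.
have -> : ev (partial_mx f theta i0 k j) =
    \sum_n ev (\adj (jacobian f) n i0) * ev (mderiv n (theta k j 0)).
  by rewrite mxE [LHS]raddf_sum; apply: eq_bigr => n _; exact: mevalM.
rewrite mulr_sumr.
under eq_bigr => n _ do rewrite mulrA adjv -mulrA [_ * ev _]mulrC.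
rewrite -mulr_sumr (eulerv _ _ (homt k j)); congr (_ * _).
by rewrite !mxE mulr_natl.
Qed.

Lemma partial_mx_det_neq0 f (theta : 'I_l -> 'cV[S]_l) i0 (v : 'cV[F]_l) :
    [pchar F] =i pred0 ->
    mx_faithful rG -> essential rG -> basic_invariants rG f ->
    invariant_vector_basis rG theta ->
    (forall k, exists d, forall i, theta k i 0 \is d.-homog) ->
    regular_vector rG v ->
    (forall i, i != i0 -> (tnth f i).@[fun j => v j 0] = 0) ->
  [/\ \det (jacobian f) != 0, \det (coord_mx theta) != 0
    & \det (partial_mx f theta i0) != 0].
Proof.
move=> F0 faith ess bf bt /fin_all_exists[d hd] regv zv.
have Jv := regular_nonvanishing faith regv (fun lam => jacobian_dvd lam bf).
have Tv := regular_nonvanishing faith regv (fun lam => coord_mx_dvd lam bt).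
have nz0 (p : S) : p.@[fun j => v j 0] != 0 -> p != 0.
  by apply: contra_neq => ->; rewrite meval0.
split; [exact: nz0 | exact: nz0 |].
have [mu Emu] := partial_mx_eval (let: And4 h _ _ _ := bf in h) hd zv.
apply: nz0; rewrite -det_map_mx.
have : \det (mu *: map_mx (meval (fun j => v j 0)) (partial_mx f theta i0)) != 0.
  rewrite Emu detZ det_mulmx det_diag det_map_mx !mulf_neq0 ?expf_neq0 //.
  (* Characteristic zero keeps the positive degree [d k] nonzero in [F]. *)
  apply/prodf_neq0 => k _; rewrite mxE (proj1 (pcharf0P F) F0) -lt0n.
  exact: invariant_basis_degree_gt0 ess bt (hd k).
(* The determinant is a factor of a nonzero product, whatever [mu] is. *)
by rewrite detZ mulf_eq0 => /norP[].
Qed.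

End AtRegularVector.

(** * The exterior algebra *)

Section ExteriorAlgebra.
Variables (R : comNzRingType) (l : nat).
Implicit Types (a b c : extform R l) (I J K : {set 'I_l}).
Local Notation "a /\* b" := (wedge a b) (at level 40, left associativity).
Local Notation mono := (@monoform R l).

(** The wedge as a function of its left factor, named so that a linear structure can be attached to
    it. *)
Definition wedger b a : extform R l := a /\* b.

Lemma wedger_linear b : linear (wedger b).
Proof.
move=> k a a'; apply/ffunP => J; rewrite !ffunE scaler_sumr -big_split.
apply: eq_bigr => I _ /=; rewrite !ffunE mulrDr mulrDl; congr (_ + _).
have /= -> : (-1) ^+ inversions I (J :\: I) * (k * a I) =
  k * ((-1) ^+ inversions I (J :\: I) * a I) by rewrite mulrCA.
exact: esym (mulrA _ _ _).
Qed.

Lemma wedge_linearr a : linear (wedge a).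
Proof.
move=> k b b'; apply/ffunP => J; rewrite !ffunE scaler_sumr -big_split.
apply: eq_bigr => I _ /=; rewrite !ffunE mulrDr; congr (_ + _).
exact: mulrCA.
Qed.

HB.instance Definition _ a :=
  GRing.isLinear.Build R (extform R l) (extform R l) *:%R (wedge a) (wedge_linearr a).
HB.instance Definition _ b :=
  GRing.isLinear.Build R (extform R l) (extform R l) *:%R (wedger b)
    (wedger_linear b).

Lemma wedge0l b : 0 /\* b = 0. Proof. exact: (linear0 (wedger b)). Qed.

Lemma wedge0r a : a /\* 0 = 0. Proof. exact: linear0. Qed.

Lemma wedgeZl k a b : (k *: a) /\* b = k *: (a /\* b).
Proof. exact: (linearZ_LR (wedger b)). Qed.

Lemma wedgeZr k a b : a /\* (k *: b) = k *: (a /\* b).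
Proof. exact: linearZ. Qed.

Lemma wedge_suml (T : Type) (r : seq T) (P : pred T) E b :
  (\sum_(i <- r | P i) E i) /\* b = \sum_(i <- r | P i) (E i /\* b).
Proof. exact: (raddf_sum (wedger b)). Qed.

Lemma wedge_sumr (T : Type) (r : seq T) (P : pred T) E a :
  a /\* (\sum_(i <- r | P i) E i) = \sum_(i <- r | P i) (a /\* E i).
Proof. exact: raddf_sum. Qed.

Lemma extform_sum a : a = \sum_J a J *: mono J.
Proof.
apply/ffunP => J; rewrite sum_ffunE (bigD1 J) //= !ffunE eqxx big1 => [|K KJ].
  by rewrite addr0; exact: esym (mulr1 _).
by rewrite !ffunE eq_sym (negPf KJ); exact: mulr0.
Qed.

Lemma wedge_mono I J : mono I /\* mono J =
  if [disjoint I & J] then (-1) ^+ inversions I J *: mono (I :|: J) else 0.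
Proof.
apply/ffunP => K; rewrite ffunE.
have eJ : (I \subset K) && (K :\: I == J) = [disjoint I & J] && (K == I :|: J).
  apply/andP/andP => [[sIK /eqP <-]|[dIJ /eqP ->]].
    split; first by rewrite -setI_eq0 setIDA setDIl setDv set0I.
    by rewrite setDE setUIr setUCr setIT (setUidPr sIK).
  by rewrite subsetUl setDUl setDv set0U (setDidPl _) // disjoint_sym.
transitivity (if (I \subset K) && (K :\: I == J)
   then (-1) ^+ inversions I J else 0 : R).
  case: ifP => [/andP[sIK /eqP eKI]|nIK].
    rewrite (bigD1 I) //= !ffunE eKI !eqxx !mulr1 big1 ?addr0 // => I' /andP[_ nI].
    by rewrite !ffunE (negPf nI) mulr0 mul0r.
  apply: big1 => I' sI'; rewrite !ffunE.
  have [eI|_] := eqVneq I' I; last by rewrite mulr0 mul0r.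
  by move: nIK; rewrite -eI sI' /= => ->; rewrite mulr0.
rewrite eJ; case: [disjoint I & J] => /=; last by rewrite ffunE.
by rewrite !ffunE; case: eqP => _; [exact: esym (mulr1 _)| exact: esym (mulr0 _)].
Qed.

Lemma inversionsUl I J K : [disjoint I & J] ->
  inversions (I :|: J) K = (inversions I K + inversions J K)%N.
Proof.
move=> dIJ; rewrite /inversions -cardsUI [X in (_ + X)%N](_ : _ = 0%N).
  rewrite addn0; apply: eq_card => p; rewrite !inE.
  by rewrite andb_orl.
apply: eq_card0 => p; rewrite !inE; case pI : (p.1 \in I) => //=.
by rewrite (disjointFr dIJ pI) andbF.
Qed.

Lemma inversionsUr I J K : [disjoint J & K] ->
  inversions I (J :|: K) = (inversions I J + inversions I K)%N.
Proof.
move=> dJK; rewrite /inversions -cardsUI [X in (_ + X)%N](_ : _ = 0%N).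
  rewrite addn0; apply: eq_card => p; rewrite !inE.
  by rewrite andb_orl andb_orr.
apply: eq_card0 => p; rewrite !inE; case pI : (p.1 \in I) => //=.
by case pJ : (p.2 \in J) => //=; rewrite (disjointFr dJK pJ) andbF.
Qed.

(** For pairwise disjoint sets both signs have exponent inv(I,J) + inv(J,K) + inv(I,K), as
    [inversions] is additive over disjoint unions; otherwise both sides are zero. *)
Lemma wedge_monoA I J K :
  mono I /\* (mono J /\* mono K) = mono I /\* mono J /\* mono K.
Proof.
rewrite (wedge_mono J K) (wedge_mono I J).
have dUr (A B C : {set 'I_l}) :
    [disjoint A & B :|: C] = [disjoint A & B] && [disjoint A & C] :> bool.
  by rewrite -!setI_eq0 setIUr setU_eq0.
have dUl (A B C : {set 'I_l}) :
    [disjoint A :|: B & C] = [disjoint A & C] && [disjoint B & C] :> bool.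
  by rewrite -!setI_eq0 setIUl setU_eq0.
have -> : mono I /\* (if [disjoint J & K]
    then (-1) ^+ inversions J K *: mono (J :|: K) else 0) =
  if [&& [disjoint I & J], [disjoint J & K] & [disjoint I & K]] then
    (-1) ^+ (inversions I J + inversions J K + inversions I K) *:
      mono (I :|: J :|: K) else 0.
  case: ifP => [dJK|]; last by rewrite andbF wedge0r.
  rewrite wedgeZr wedge_mono dUr andTb; case: ifP => [_|]; last by rewrite scaler0.
  by rewrite scalerA -exprD inversionsUr // addnA setUA (addnC (inversions J K)).
case dIJ : [disjoint I & J]; last by rewrite wedge0l.
rewrite wedgeZl wedge_mono dUl andTb andbC; case: ifP => [_|]; last by rewrite scaler0.
by rewrite scalerA -exprD inversionsUl // -addnA (addnC (inversions J K)).
Qed.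

Lemma wedgeA : associative (@wedge R l).
Proof.
move=> a b c; rewrite (extform_sum a) !wedge_suml; apply: eq_bigr => I _.
rewrite !wedgeZl; congr (_ *: _).
rewrite (extform_sum b) wedge_sumr !wedge_suml wedge_sumr; apply: eq_bigr => J _.
rewrite !(wedgeZl, wedgeZr); congr (_ *: _).
rewrite (extform_sum c) !wedge_sumr; apply: eq_bigr => K _.
by rewrite !wedgeZr wedge_monoA.
Qed.

Lemma wedge1l : left_id (mono set0) (@wedge R l).
Proof.
move=> a; rewrite [in LHS](extform_sum a) wedge_sumr [RHS]extform_sum.
apply: eq_bigr => J _; rewrite wedgeZr wedge_mono disjoints_subset sub0set set0U.
rewrite [inversions _ _](_ : _ = 0%N) ?scale1r //.
by apply: eq_card0 => p; rewrite !inE.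
Qed.

Lemma wedge1r : right_id (mono set0) (@wedge R l).
Proof.
move=> a; rewrite [in LHS](extform_sum a) wedge_suml [RHS]extform_sum.
apply: eq_bigr => J _; rewrite wedgeZl wedge_mono disjoint_sym.
rewrite disjoints_subset sub0set setU0 [inversions _ _](_ : _ = 0%N) ?scale1r //.
by apply: eq_card0 => p; rewrite !inE andbF.
Qed.

HB.instance Definition _ :=
  Monoid.isLaw.Build (extform R l) (mono set0) (@wedge R l) wedgeA wedge1l wedge1r.

Definition one_form (u : 'I_l -> R) : extform R l :=
  \sum_i (u i : R) *: mono [set i].

Lemma wedge_mono1 i j : mono [set i] /\* mono [set j] =
  if i == j then 0 else (-1) ^+ (j < i)%N *: mono [set i; j].
Proof.
rewrite wedge_mono disjoints1 inE; case: eqP => //= _; congr ((-1) ^+ _ *: _).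
rewrite /inversions; case: ltnP => ij.
  rewrite (@eq_card1 _ (i, j)) // => p; rewrite !inE -pair_eqE /=.
  by case: eqP => //= ->; case: eqP => //= ->.
rewrite eq_card0 // => p; rewrite !inE.
by case: eqP => //= ->; case: eqP => //= ->; rewrite ltnNge ij.
Qed.

Lemma wedge_mono1C i j :
  mono [set i] /\* mono [set j] = - (mono [set j] /\* mono [set i]).
Proof.
rewrite !wedge_mono1 eq_sym; case: eqP => [_|/eqP ij]; first by rewrite oppr0.
rewrite setUC -scaleNr; congr (_ *: _).
by case: (ltngtP i j) => [||/val_inj/eqP];
  rewrite ?expr0 ?expr1 ?opprK // eq_sym (negPf ij).
Qed.

Lemma one_form_wedgeC u v :
  one_form u /\* one_form v = - (one_form v /\* one_form u).
Proof.
rewrite !wedge_suml; under eq_bigr => i _ do rewrite wedge_sumr.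
under [in RHS]eq_bigr => i _ do rewrite wedge_sumr.
rewrite exchange_big -sumrN; apply: eq_bigr => j _; rewrite -sumrN.
apply: eq_bigr => i _; rewrite !(wedgeZl, wedgeZr) wedge_mono1C !scalerN.
by rewrite !scalerA mulrC.
Qed.

(** Antisymmetry alone shows only that twice the square is zero; here the terms with i < j cancel
    those with j < i, and the diagonal terms are zero. *)
Lemma one_form_wedge0 u : one_form u /\* one_form u = 0.
Proof.
rewrite !wedge_suml; under eq_bigr => i _ do rewrite wedge_sumr.
rewrite pair_bigA (bigID (fun p : 'I_l * 'I_l => (p.1 < p.2)%N)) /=.
rewrite [X in _ + X](bigID (fun p : 'I_l * 'I_l => p.1 == p.2)) /=.
rewrite [X in _ + (X + _)]big1 ?add0r => [|[i j] /= /andP[_ /eqP->]]; last first.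
  by rewrite wedgeZl wedgeZr wedge_mono1 eqxx !scaler0.
have swapI : injective (fun p : 'I_l * 'I_l => (p.2, p.1)).
  by move=> [a b] [c d] /= [-> ->].
rewrite [X in _ + X](reindex_inj swapI) /= addrC.
apply/eqP; rewrite addr_eq0 -sumrN; apply/eqP; apply: eq_big => [[i j]|[i j] _] /=.
  by rewrite -leqNgt -(inj_eq val_inj) /= eq_sym ltn_neqAle andbC.
by rewrite !(wedgeZl, wedgeZr) wedge_mono1C !scalerN !scalerA mulrC.
Qed.

End ExteriorAlgebra.

Section WedgeProducts.
Variables (R : comNzRingType) (l : nat) (c : 'I_l -> 'I_l -> R).
Implicit Types s t : seq 'I_l.
Local Notation phi i := (one_form (c i)).

Definition wedge_prod s : extform R l :=
  \big[@wedge R l/monoform R set0]_(i <- s) phi i.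

Lemma wedge_prod_cons i s : wedge_prod (i :: s) = wedge (phi i) (wedge_prod s).
Proof. exact: big_cons. Qed.

Lemma wedge_prod_cat s t :
  wedge_prod (s ++ t) = wedge (wedge_prod s) (wedge_prod t).
Proof. exact: big_cat. Qed.

Lemma wedge_prod_rcons s i : wedge_prod (rcons s i) = wedge (wedge_prod s) (phi i).
Proof. by rewrite -cats1 wedge_prod_cat {2}/wedge_prod big_seq1. Qed.

Lemma one_form_wedge_prod i s :
  wedge (phi i) (wedge_prod s) = (-1) ^+ size s *: wedge (wedge_prod s) (phi i).
Proof.
elim: s => [|j s IH] /=.
  by rewrite /wedge_prod big_nil wedge1r wedge1l scale1r.
rewrite wedge_prod_cons wedgeA one_form_wedgeC -scaleN1r wedgeZl -wedgeA IH.
by rewrite wedgeZr scalerA exprS wedgeA.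
Qed.

Lemma wedge_prod_catC s t :
  exists n : nat, wedge_prod (s ++ t) = (-1) ^+ n *: wedge_prod (t ++ s).
Proof.
elim: s t => [|i s IH] t; first by exists 0%N; rewrite cats0 scale1r.
have [n En] := IH (rcons t i); exists (n + size (s ++ t))%N.
rewrite cat_cons wedge_prod_cons one_form_wedge_prod -wedge_prod_rcons rcons_cat.
by rewrite En scalerA -exprD addnC cat_rcons.
Qed.

(** Swaps of adjacent blocks generate all permutations. The sign stays existential because the
    results serve membership in subspaces. *)
Lemma wedge_prod_perm s t :
  perm_eq s t -> exists n : nat, wedge_prod s = (-1) ^+ n *: wedge_prod t.
Proof.
pose P u := exists n : nat, wedge_prod s = (-1) ^+ n *: wedge_prod u.
move=> /(catCA_perm_ind (P := P)).
apply; last by exists 0%N; rewrite scale1r.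
rewrite /P => s1 s2 s3 [n ->]; have [k Ek] := wedge_prod_catC s1 s2.
exists (n + k)%N; rewrite catA wedge_prod_cat Ek wedgeZl -wedge_prod_cat catA.
by rewrite scalerA exprD.
Qed.

(** A repeated factor can be moved next to its copy, up to sign. *)
Lemma wedge_prod_not_uniq s : ~~ uniq s -> wedge_prod s = 0.
Proof.
elim: s => //= i s IH; rewrite wedge_prod_cons negb_and negbK => /orP[si|/IH->].
  have [n ->] := wedge_prod_perm (perm_to_rem si).
  by rewrite wedgeZr wedge_prod_cons wedgeA one_form_wedge0 wedge0l scaler0.
exact: wedge0r.
Qed.

Lemma wedge_prod_set s : uniq s ->
  exists n : nat, wedge_prod s = (-1) ^+ n *: wedge_prod (enum [set i in s]).
Proof.
move=> us; apply: wedge_prod_perm; apply: uniq_perm (enum_uniq _) _ => // i.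
by rewrite mem_enum inE.
Qed.

End WedgeProducts.

Lemma one_form_delta (R : comNzRingType) l (j : 'I_l) :
  one_form (fun i => (i == j)%:R) = monoform R [set j].
Proof.
rewrite /one_form (bigD1 j) //= eqxx scale1r big1 ?addr0 // => i /negPf->.
exact: scale0r.
Qed.

Lemma monoform_wedge_prod (R : comNzRingType) l (s : seq 'I_l) : uniq s ->
  exists n : nat, monoform R [set i in s] =
    (-1) ^+ n *: wedge_prod (fun j i => (i == j)%:R) s.
Proof.
elim: s => [_|j s IH /= /andP[js us]].
  exists 0%N; rewrite /wedge_prod big_nil scale1r.
  suff -> : [set i in [::]] = set0 :> {set 'I_l} by [].
  by apply/setP => i; rewrite !inE.
have [n En] := IH us; rewrite wedge_prod_cons one_form_delta.
exists (n + inversions [set j] [set i in s])%N.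
have -> : wedge_prod (fun j i => (i == j)%:R) s = (-1) ^+ n *: monoform R [set i in s].
  by rewrite En scalerA -exprD addnn -signr_odd odd_double scale1r.
rewrite wedgeZr wedge_mono disjoints1 inE js !scalerA -!exprD.
rewrite -addnA addnn -signr_odd odd_double scale1r.
suff -> : [set i in j :: s] = [set j] :|: [set i in s] by [].
by apply/setP => i; rewrite !inE.
Qed.

(** * The exchange argument *)

Section Spanning.
Variables (K : fieldType) (l : nat) (c : 'I_l -> 'I_l -> K) (i0 : 'I_l).
Local Notation phi i := (one_form (c i)).
Local Notation W := (wedge_prod c).

Definition tensv (w : extform K l) (u : 'I_l -> K) : vecform K l :=
  [ffun j => (u j : K) *: w].

Lemma tensvZl k w u : tensv (k *: w) u = k *: tensv w u.
Proof. by apply/ffunP => j; rewrite !ffunE !scalerA mulrC. Qed.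

Lemma tensv_suml (I : finType) (P : pred I) (w : I -> extform K l) u :
  tensv (\sum_(i | P i) w i) u = \sum_(i | P i) tensv (w i) u.
Proof.
apply/ffunP => j; rewrite !ffunE sum_ffunE scaler_sumr.
by apply: eq_bigr => i _; rewrite ffunE.
Qed.

Lemma tensv_comb w (I : finType) (k : I -> K) (e : I -> 'I_l -> K) u :
  (forall j, u j = \sum_i k i * e i j) -> tensv w u = \sum_i k i *: tensv w (e i).
Proof.
move=> Eu; apply/ffunP => j; rewrite !ffunE sum_ffunE Eu scaler_suml.
by apply: eq_bigr => i _; rewrite !ffunE scalerA.
Qed.

Variables (A B C : 'I_l -> 'I_l -> K) (th : 'I_l -> 'I_l -> K).
(* [Q k i] holds the coefficients of [phi i] in [dtheta_k]. *)
Variable Q : 'I_l -> 'I_l -> 'I_l -> K.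
(** By [hA] the [phi i] span the one-forms, by [hB] the [th k] span the vectors, and by [hC] so do
    the components [Q k i0] of the dtheta_k along [phi i0]. *)
Hypothesis hA : forall n, monoform K [set n] = \sum_i A n i *: phi i.
Hypothesis hB : forall j j', (j' == j)%:R = \sum_k B j k * th k j'.
Hypothesis hC : forall j j', (j' == j)%:R = \sum_k C j k * Q k i0 j'.

Variables (m : nat) (U : {vspace vecform K l}).
Hypothesis U_theta : forall I : {set 'I_l}, i0 \notin I -> #|I| = m ->
  forall k, tensv (W (enum I)) (th k) \in U.
Hypothesis U_dtheta : forall I : {set 'I_l}, i0 \notin I -> (#|I|).+1 = m ->
  forall k, wedgev (W (enum I)) [ffun j => \sum_i Q k i j *: phi i] \in U.

Lemma tensv_delta w (u : 'I_l -> K) :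
  tensv w u = \sum_j u j *: tensv w (fun j' => (j' == j)%:R).
Proof.
apply: tensv_comb => j; rewrite (bigD1 j) //= eqxx mulr1 big1 ?addr0 // => j' j'j.
by rewrite eq_sym (negPf j'j) mulr0.
Qed.

Lemma tensv_set_mem (I : {set 'I_l}) u : i0 \notin I -> #|I| = m ->
  tensv (W (enum I)) u \in U.
Proof.
move=> i0I cI; rewrite tensv_delta; apply: memv_suml => j _; apply: memvZ.
rewrite (tensv_comb _ (hB j)); apply: memv_suml => k _; apply: memvZ.
exact: U_theta.
Qed.

Lemma tensv_seq_mem s u : i0 \notin s -> size s = m -> tensv (W s) u \in U.
Proof.
move=> i0s ss; have [us|nus] := boolP (uniq s); last first.
  rewrite wedge_prod_not_uniq // -[0](scale0r (W s)) tensvZl scale0r; exact: mem0v.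
have [n ->] := wedge_prod_set c us; rewrite tensvZl memvZ //.
by apply: tensv_set_mem; rewrite ?inE // cardsE (card_uniqP us).
Qed.

(** If [i0] occurs, it is moved to the end, and by [hC] it suffices to treat u = [Q k i0]. This term
    is the [phi i0] component of a product with dtheta_k, which lies in [U]; the remaining
    components avoid [i0] and are covered by [tensv_seq_mem]. *)
Lemma tensv_any_seq_mem s u : size s = m -> tensv (W s) u \in U.
Proof.
move=> ss; have [i0s|] := boolP (i0 \in s); last by move=> ?; exact: tensv_seq_mem.
have : perm_eq s (rcons (rem i0 s) i0).
  by rewrite (perm_trans (perm_to_rem i0s)) // perm_sym perm_rcons.
case/(wedge_prod_perm c) => n ->; rewrite tensvZl memvZ //.
have : (size (rem i0 s)).+1 = m by rewrite -ss (perm_size (perm_to_rem i0s)).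
move: (rem i0 s) => {ss i0s s} s ss.
have [us|nus] := boolP (uniq (rcons s i0)); last first.
  rewrite wedge_prod_not_uniq // -[0](scale0r (W s)) tensvZl scale0r; exact: mem0v.
move: us; rewrite rcons_uniq => /andP[i0s us].
have Ud k : wedgev (W s) [ffun j => \sum_i Q k i j *: phi i] \in U.
  have [n' ->] := wedge_prod_set c us.
  set w := W _; have -> : forall x, wedgev ((-1) ^+ n' *: w) x = (-1) ^+ n' *: wedgev w x.
    by move=> x; apply/ffunP => j; rewrite !ffunE wedgeZl.
  rewrite memvZ // U_dtheta ?inE // cardsE (card_uniqP us) //.
rewrite tensv_delta; apply: memv_suml => j _; apply: memvZ.
rewrite (tensv_comb _ (hC j)); apply: memv_suml => k _; apply: memvZ.
have -> : tensv (W (rcons s i0)) (Q k i0) =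
   wedgev (W s) [ffun j => \sum_i Q k i j *: phi i] -
   \sum_(i | i != i0) tensv (W (rcons s i)) (Q k i).
  apply/ffunP => j'; rewrite !ffunE sum_ffunE wedge_sumr (bigD1 i0) //=.
  under [X in _ - X]eq_bigr => i _ do rewrite ffunE wedge_prod_rcons -wedgeZr.
  by rewrite addrK wedge_prod_rcons wedgeZr.
apply: memvB (Ud k) _; apply: memv_suml => i ii0.
by apply: tensv_seq_mem; rewrite ?size_rcons // mem_rcons inE negb_or eq_sym ii0.
Qed.

Lemma vecmono_mem (J : {set 'I_l}) j : #|J| = m -> vecmono K J j \in U.
Proof.
move=> cJ; have -> : vecmono K J j = tensv (monoform K J) (fun j' => (j' == j)%:R).
  by apply/ffunP => j'; rewrite !ffunE; case: eqP => _; rewrite ?scale1r ?scale0r.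
have -> : J = [set i in enum J] by apply/setP => i; rewrite inE mem_enum.
have [n ->] := monoform_wedge_prod K (enum_uniq J); rewrite tensvZl memvZ //.
set u := fun j' : 'I_l => (j' == j)%:R.
(* The coordinate forms in [t] are replaced one at a time by combinations of the [phi i], which
   accumulate in [s]. *)
suff : forall t s, (size s + size t)%N = m ->
    tensv (wedge (W s) (wedge_prod (fun j i => (i == j)%:R) t)) u \in U.
  move/(_ (enum J) [::]); rewrite {1}/wedge_prod big_nil wedge1l.
  by apply; rewrite -cardE.
elim=> [|i t IH] s.
  rewrite addn0 {2}/wedge_prod big_nil wedge1r; exact: tensv_any_seq_mem.
move=> sz; rewrite wedge_prod_cons one_form_delta hA wedge_suml wedge_sumr tensv_suml.
apply: memv_suml => i' _; rewrite wedgeZl wedgeZr tensvZl memvZ //.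
by rewrite wedgeA -wedge_prod_rcons IH // size_rcons addSnnS.
Qed.

End Spanning.

(** * Forms over the fraction field *)

Section MapForms.
Variables (R R' : comNzRingType) (h : {rmorphism R -> R'}) (l : nat).

Definition map_extform (a : extform R l) : extform R' l :=
  [ffun J : {set 'I_l} => h (a J)].

Lemma map_wedge a b :
  map_extform (wedge a b) = wedge (map_extform a) (map_extform b).
Proof.
apply/ffunP => J; rewrite !ffunE raddf_sum; apply: eq_bigr => I _.
rewrite !ffunE [LHS](rmorphM h); congr (_ * _); rewrite [LHS](rmorphM h).
by congr (_ * _); rewrite [LHS](rmorph_sign h).
Qed.

Lemma map_monoform J : map_extform (monoform R J) = monoform R' J.
Proof. by apply/ffunP => I; rewrite !ffunE rmorph_nat. Qed.

Lemma map_extformZ k a : map_extform (k *: a) = h k *: map_extform a.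
Proof. by apply/ffunP => I; rewrite !ffunE; exact: rmorphM. Qed.

Lemma map_one_form u : map_extform (one_form u) = one_form (h \o u).
Proof.
apply/ffunP => I; rewrite ffunE !sum_ffunE raddf_sum; apply: eq_bigr => i _.
by rewrite -map_monoform -map_extformZ [RHS]ffunE.
Qed.

End MapForms.

Section FractionForms.
Variables (F : fieldType) (l : nat).
Notation S := {mpoly F[l]}.
Notation K := {fraction S}.
Local Notation frac := (@tofrac S).

Lemma dform_coef (p : S) : dform (p *: monoform S set0) = dpoly p.
Proof.
apply: eq_bigr => n _.
have -> : [ffun J : {set 'I_l} => mderiv n ((p *: monoform S set0 : extform S l) J) : S]
    = mderiv n p *: monoform S set0 :> extform S l.
  have coefE (q : S) J : (q *: monoform S set0 : extform S l) J = q * (J == set0)%:R.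
    by rewrite ffunE [X in _ *: X]ffunE.
  apply/ffunP => J; rewrite [LHS]ffunE.
  apply: etrans (congr1 (mderiv n) (coefE p J)) (etrans _ (esym (coefE _ J))).
  by case: (J == set0); rewrite ?mulr1 // !mulr0 mderiv0.
by rewrite wedgeZr wedge1r.
Qed.

Lemma frac_dpolys (f : l.-tuple S) (A : {set 'I_l}) :
  map_extform frac (dpolys f A) =
  wedge_prod (fun i n => frac (jacobian f i n)) (enum A).
Proof.
rewrite /dpolys (big_morph _ (map_wedge frac (l := l)) (map_monoform frac set0)).
apply: eq_bigr => i _; rewrite map_one_form.
by apply: eq_bigr => n _; rewrite mxE.
Qed.

Lemma frac_theta f A (t : 'cV[S]_l) :
  frac_vecform (wedgev (dpolys f A) (vec_to_vecform t)) =
  tensv (wedge_prod (fun i n => frac (jacobian f i n)) (enum A))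
    (fun j => frac (t j 0)).
Proof.
apply/ffunP => j; rewrite !ffunE -frac_dpolys -[LHS]/(map_extform frac _) map_wedge.
by rewrite map_extformZ map_monoform wedgeZr wedge1r.
Qed.

Lemma frac_dtheta f A (t : 'cV[S]_l) :
  frac_vecform (wedgev (dpolys f A) (dvec (vec_to_vecform t))) =
  wedgev (wedge_prod (fun i n => frac (jacobian f i n)) (enum A))
    [ffun j => one_form (fun n => frac (mderiv n (t j 0)))].
Proof.
apply/ffunP => j; rewrite !ffunE -frac_dpolys -[LHS]/(map_extform frac _) map_wedge.
by rewrite dform_coef map_one_form.
Qed.

End FractionForms.

(** * Counting dimensions *)

Section Dimension.
Variables (K : fieldType) (l : nat).

Lemma span_coef0 (X : seq (vecform K l)) J i :
  (forall x, x \in X -> x i J = 0) -> forall v, v \in <<X>>%VS -> v i J = 0.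
Proof.
move=> X0 v /(coord_span (X := in_tuple X)) ->.
rewrite sum_ffunE sum_ffunE big1 // => n _; rewrite !ffunE X0 ?mem_nth //.
exact: mulr0.
Qed.

Lemma vecmono_coef (J J' : {set 'I_l}) i i' :
  vecmono K J i i' J' = ((J' == J) && (i' == i))%:R.
Proof. by rewrite ffunE; case: eqP => _; rewrite !ffunE ?andbT // andbF. Qed.

(** The coefficient at (J, i) separates [vecmono K J i] from the span of the others. *)
Lemma free_vecmono (r : seq ({set 'I_l} * 'I_l)) :
  uniq r -> free [seq vecmono K p.1 p.2 | p <- r].
Proof.
elim: r => [_|[J i] r IH /= /andP[nr ur]]; first exact: nil_free.
rewrite free_cons IH // andbT; apply/negP => /span_coef0-/(_ J i).
rewrite vecmono_coef !eqxx => /(_ _)/eqP; rewrite oner_eq0 => H; apply/notF/H.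
move=> _ /mapP[[J' i'] rJ ->]; rewrite vecmono_coef; case: andP => //= -[/eqP eJ /eqP ei].
by rewrite eJ ei rJ in nr.
Qed.

End Dimension.

Lemma dim_vecform_space (D : idomainType) l m :
  (#|[set J : {set 'I_l} | #|J| == m]| * l <= \dim (vecform_space D l m))%N.
Proof.
pose r := [seq (J, i) | J <- enum [set J : {set 'I_l} | #|J| == m], i <- enum 'I_l].
have ur : uniq r by apply: allpairs_uniq; rewrite ?enum_uniq // => -[? ?] [? ?].
have := free_vecmono {fraction D} ur; rewrite /free size_map size_allpairs -cardE.
rewrite size_enum_ord => /eqP <-; apply: dimvS; apply/span_subvP => _ /mapP[[J i] + ->].
case/allpairsP=> -[J' i'] /= [+ _ [-> ->]]; rewrite mem_enum inE => cJ.
apply: subvP (memv_line _); rewrite /vecform_space.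
apply: (subv_trans _ (sumv_sup J' cJ (subvv _))).
exact: (sumv_sup i').
Qed.

(** Deleting [i0] matches the m-subsets that contain it with the (m-1)-subsets that avoid it, so the
    products with dtheta_k replace exactly the missing df_I theta_k. *)
Lemma card_sets_pivot l (i0 : 'I_l) m :
  #|[set J : {set 'I_l} | #|J| == m]| =
  (#|[set A : {set 'I_l} | (i0 \notin A) && (#|A|.+1 == m)]|
   + #|[set A : {set 'I_l} | (i0 \notin A) && (#|A| == m)]|)%N.
Proof.
rewrite -(cardsID [set J : {set 'I_l} | i0 \in J]); congr (_ + _)%N; last first.
  by apply: eq_card => J; rewrite !inE.
rewrite -[RHS](card_in_imset (f := fun A => i0 |: A)); last first.
  move=> A B; rewrite !inE => /andP[nA _] /andP[nB _] /(congr1 (fun J => J :\ i0)).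
  by rewrite !setU1K.
apply: eq_card => J; rewrite !inE; apply/andP/imsetP => [[/eqP cJ iJ]|[A + ->]].
  by exists (J :\ i0); rewrite ?setD1K // !inE eqxx /= -cJ (cardsD1 i0 J) iJ.
by rewrite in_set => /andP[nA /eqP <-]; rewrite setU11 cardsU1 nA.
Qed.

Section ThetaFamily.
Variables (F : fieldType) (l : nat) (f : l.-tuple {mpoly F[l]}).
Variables (theta : 'I_l -> 'cV[{mpoly F[l]}]_l) (i0 : 'I_l) (m : nat).
Notation S := {mpoly F[l]}.
Notation K := {fraction S}.
Local Notation frac := (@tofrac S).

Lemma size_theta_family :
  size (theta_family f theta i0 m) = (#|[set J : {set 'I_l} | #|J| == m]| * l)%N.
Proof.
rewrite /theta_family size_cat [X in (X + _)%N]size_allpairs.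
rewrite [X in (_ + X)%N]size_allpairs size_enum_ord -!cardE.
by rewrite -mulnDl -card_sets_pivot.
Qed.

Lemma theta_family_span :
    \det (jacobian f) != 0 -> \det (coord_mx theta) != 0 ->
    \det (partial_mx f theta i0) != 0 ->
  (vecform_space S l m <= <<theta_family f theta i0 m>>)%VS.
Proof.
move=> nJ nT nP.
pose FM (M : 'M[S]_l) : 'M[K]_l := map_mx frac M.
have tofrac_neq0 (p : S) : p != 0 -> frac p != 0 by rewrite tofrac_eq0.
have inv (M : 'M[S]_l) : \det M != 0 -> invmx (FM M) *m FM M = 1%:M.
  by move=> nM; apply: mulVmx; rewrite unitmxE det_map_mx unitfE tofrac_neq0.
pose D := frac (\det (jacobian f)); have nD : D != 0 := tofrac_neq0 _ nJ.
(* [A] inverts the Jacobian, so [A n i] is dx_n/df_i and [Q k i j] is the derivative of the j-th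
   coordinate of [theta k] along f_i; [partial_mx] is [D] times the matrix of the [Q k i0 j]. *)
pose A n i := D^-1 * frac (\adj (jacobian f) n i).
pose Q k i j := \sum_n frac (mderiv n (theta k j 0)) * A n i.
have AJ n n' : \sum_i A n i * frac (jacobian f i n') = (n' == n)%:R.
  rewrite /A; under eq_bigr => i _ do rewrite -mulrA -rmorphM.
  rewrite -mulr_sumr -raddf_sum.
  have /matrixP/(_ n n') := mul_adj_mx (jacobian f); rewrite mxE => ->.
  by rewrite mxE eq_sym; case: eqP => _; rewrite ?mulVf // raddf0 mulr0.
have hA n : monoform K [set n] =
    \sum_i A n i *: one_form (fun n => frac (jacobian f i n)).
  rewrite -one_form_delta; under [RHS]eq_bigr => i _ do rewrite scaler_sumr.
  rewrite exchange_big; apply: eq_bigr => n' _ /=; rewrite -AJ scaler_suml.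
  by apply: eq_bigr => i _; rewrite scalerA.
have hB j j' : (j' == j)%:R =
    \sum_k invmx (FM (coord_mx theta)) j k * frac (theta k j' 0).
  have /matrixP/(_ j j') := inv _ nT; rewrite !mxE eq_sym => <-.
  by apply: eq_bigr => k _; rewrite !mxE.
have hC j j' : (j' == j)%:R =
    \sum_k (D * invmx (FM (partial_mx f theta i0)) j k) * Q k i0 j'.
  have /matrixP/(_ j j') := inv _ nP; rewrite !mxE eq_sym => <-.
  apply: eq_bigr => k _; rewrite [D * _]mulrC -mulrA; congr (_ * _).
  rewrite !mxE raddf_sum mulr_sumr; apply: eq_bigr => n _.
  by rewrite /A [RHS]mulrCA mulVKf // [RHS]mulrC [LHS]rmorphM.
apply/subv_sumP => J /eqP cJ; apply/subv_sumP => j _; rewrite -memvE.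
apply: (vecmono_mem hA hB hC) cJ => I i0I cI k; apply: memv_span.
  rewrite mem_cat; apply/orP; right; apply/allpairsP; exists (I, k).
  by rewrite !mem_enum inE i0I cI eqxx frac_theta.
rewrite mem_cat; apply/orP; left; apply/allpairsP; exists (I, k).
rewrite !mem_enum inE i0I cI eqxx frac_dtheta; split=> //; congr wedgev.
apply/ffunP => j'; rewrite !ffunE /Q /one_form.
under [LHS]eq_bigr => i _ do rewrite scaler_suml.
rewrite exchange_big; apply: eq_bigr => n _ /=; rewrite hA scaler_sumr.
by apply: eq_bigr => i _; rewrite scalerA.
Qed.

End ThetaFamily.

Lemma theta_family_basis (F : fieldType) (l : nat) (f : l.-tuple {mpoly F[l]})
    (theta : 'I_l -> 'cV[{mpoly F[l]}]_l) (i0 : 'I_l) (m : nat) :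
    \det (jacobian f) != 0 -> \det (coord_mx theta) != 0 ->
    \det (partial_mx f theta i0) != 0 ->
  basis_of (vecform_space {mpoly F[l]} l m) (theta_family f theta i0 m).
Proof.
move=> nJ nT nP; rewrite basisEdim; apply/andP; split.
  exact: theta_family_span.
by rewrite size_theta_family; exact: dim_vecform_space.
Qed.

Theorem theorem7p3 (R : realType) (l : nat)
    (gT : finGroupType) (W : {group gT}) (rW : mx_representation R[i] W l)
    (hW : reflection_group rW) (hess : essential rW)
    (f : l.-tuple {mpoly R[i][l]}) (hf : basic_invariants rW f)
    (theta : 'I_l -> 'cV[{mpoly R[i][l]}]_l)
    (htheta : invariant_vector_basis rW theta)
    (theta_homog : forall k, exists d : nat, forall i, theta k i 0 \is d.-homog)
    (i0 : 'I_l)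
    (hi0 : exists v : 'cV[R[i]]_l, regular_vector rW v /\
             forall i, i != i0 -> (tnth f i).@[fun j => v j 0] = 0)
    (m : nat) (hm : (m <= l)%N) :
  basis_of (vecform_space {mpoly R[i][l]} l m) (theta_family f theta i0 m).
Proof.
have [v [regv zv]] := hi0; have [faithW _] := hW.
have [nJ nT nP] :=
  partial_mx_det_neq0 (Num.Theory.pchar_num _) faithW hess hf htheta theta_homog regv zv.
have basis := @theta_family_basis _ l f theta i0 m nJ nT nP.
exact basis.
Qed.
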